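(* Let $\omega_0>0$, $0<\zeta<1$ and $u^-\in\mathcal{L}^2([0,2\pi];\mathbb{R})$. Put $\alpha=\omega_0\zeta$, $\widetilde\beta=\omega_0\sqrt{1-\zeta^2}$ and $\gamma=\tan^{-1}(-\alpha/\widetilde\beta)$. The projection $P_{\mathcal{A}_{\omega_0,\zeta}}$ of $u^-$ onto the constraint set $\mathcal{A}_{\omega_0,\zeta}$, as the solution of the problem of minimizing $\frac12\|u-u^-\|_{\mathcal{L}^2}^2$ subject to $u\in\mathcal{A}_{\omega_0,\zeta}$, is given by $$P_{\mathcal{A}_{\omega_0,\zeta}}(u^-)(t)=u^-(t)+\frac{e^{\alpha(t-2\pi)}}{\widetilde\beta^2\big(y_{11}(2\pi)y_{22}(2\pi)-y_{12}(2\pi)y_{21}(2\pi)\big)}\bigg(-\big(y_{22}(2\pi)\sin(\widetilde\beta t)+y_{12}(2\pi)\,\omega_0\cos(\widetilde\beta t+\gamma)\big)\Big(x_1(2\pi)-\frac{\widetilde\beta s_f}{e^{-2\pi\alpha}}\Big)+\big(y_{21}(2\pi)\sin(\widetilde\beta t)+y_{11}(2\pi)\,\omega_0\cos(\widetilde\beta t+\gamma)\big)\Big(x_2(2\pi)-\frac{\widetilde\beta v_f}{e^{-2\pi\alpha}}\Big)\bigg),$$ where $$y_{11}(2\pi)=\frac{e^{-2\pi\alpha}}{4\omega_0^2}\left(\frac{\cos(2\pi\widetilde\beta)(1-e^{4\pi\alpha})}{\alpha}+\frac{\sin(2\pi\widetilde\beta)(1+e^{4\pi\alpha})}{\widetilde\beta}\right),\qquad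 y_{12}(2\pi)=\frac{\sinh(2\pi\alpha)\sin(2\pi\widetilde\beta)}{2\alpha\widetilde\beta},$$ $$y_{21}(2\pi)=-\frac{\sinh(2\pi\alpha)\sin(2\pi\widetilde\beta)}{2\alpha\widetilde\beta},\qquad y_{22}(2\pi)=\frac{e^{-2\pi\alpha}}{4}\left(\frac{\cos(2\pi\widetilde\beta)(1-e^{4\pi\alpha})}{\alpha}-\frac{\sin(2\pi\widetilde\beta)(1+e^{4\pi\alpha})}{\widetilde\beta}\right),$$ and $(x_1(2\pi),x_2(2\pi))$ is the value at $t=2\pi$ of the solution of $\dot x_1=x_2$, $\dot x_2=-\omega_0^2x_1-2\zeta\omega_0x_2+u^-$, $x_1(0)=s_0$, $x_2(0)=v_0$.
   Context: $\mathcal{L}^2([0,2\pi];\mathbb{R})$ is the Hilbert space of Lebesgue measurable functions $z:[0,2\pi]\to\mathbb{R}$ with finite norm $\|z\|_{\mathcal{L}^2}=\big(\int_0^{2\pi}|z(t)|^2\,dt\big)^{1/2}$, and $\mathcal{W}^{1,2}([0,2\pi];\mathbb{R}^2)$ is the Sobolev space of absolutely continuous functions in $\mathcal{L}^2([0,2\pi];\mathbb{R}^2)$ whose derivative is in $\mathcal{L}^2([0,2\pi];\mathbb{R}^2)$. For given $s_0,s_f,v_0,v_f\in\mathbb{R}$ (with final time $t_f=2\pi$), $$\mathcal{A}_{\omega_0,\zeta}:=\{u\in\mathcal{L}^2([0,2\pi];\mathbb{R}):\exists x\in\mathcal{W}^{1,2}([0,2\pi];\mathbb{R}^2)\text{ which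 solves }\dot x_1=x_2,\ x_1(0)=s_0,\ x_1(2\pi)=s_f,\ \dot x_2=-\omega_0^2x_1-2\zeta\omega_0x_2+u,\ x_2(0)=v_0,\ x_2(2\pi)=v_f\}.$$ This is the set of unconstrained controls steering the under-damped harmonic oscillator with natural frequency $\omega_0$ and damping ratio $\zeta$ from $(s_0,v_0)$ to $(s_f,v_f)$.
   Formalization: The printed formula fails (e.g. for u⁻ already in the set with nonzero target); the formal version replaces x_i(2π) in the two brackets by β̃x_i(2π)/e^{−2πα}, the same scaling as the target s_f, v_f. *)

(* Defs.v *)
From HB Require Import structures.
From mathcomp Require Import all_boot all_order all_algebra.
From mathcomp Require Import all_classical all_reals all_analysis.

Set Implicit Arguments.
Unset Strict Implicit.
Unset Printing Implicit Defensive.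

Import Order.TTheory GRing.Theory Num.Theory.
Import numFieldNormedType.Exports.

Local Open Scope classical_set_scope.
Local Open Scope ring_scope.

Definition sinh (R : realType) (x : R) : R := (expR x - expR (- x)) / 2.

(* Lebesgue measure on [0, 2pi]. A function on [0, 2pi] is represented by a
   (Borel) function on R whose values off [0, 2pi] are invisible to this
   measure; `{ae muI R, _}` thus means "almost everywhere on [0, 2pi]". *)
Definition muI (R : realType) : {measure set (measurableTypeR R) -> \bar R} :=
  mrestr (@lebesgue_measure R)
    (measurable_itv `[0, 2 * pi] : measurable (`[0, 2 * pi] : set R)).

Definition L2 (R : realType) : set (R -> R) :=
  [set u | u \in Lfun (@muI R) 2%:E].

Definition L2norm (R : realType) (u : R -> R) : R :=
  fine ('N[@muI R]_2%:E[EFin \o u])%E.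

Definition abs_continuous (R : realType) (a b : R) (f : R -> R) : Prop :=
  forall e : R, 0 < e -> exists2 d : R, 0 < d &
    forall (n : nat) (l r : 'I_n -> R),
      (forall i, [/\ a <= l i, l i <= r i & r i <= b]) ->
      trivIset setT (fun i => `]l i, r i[%classic) ->
      \sum_i (r i - l i) < d ->
      \sum_i `|f (r i) - f (l i)| < e.

(* x' = g almost everywhere on [0, 2pi]. *)
Definition ae_deriv (R : realType) (x g : R -> R) : Prop :=
  {ae @muI R, forall t : R, is_derive t 1 x (g t)}.

Definition W12 (R : realType) : set (R -> R) :=
  [set x | abs_continuous 0 (2 * pi) x /\ exists2 g, L2 g & ae_deriv x g].

(* (x1, x2) in W^{1,2}([0, 2pi]; R^2), taken componentwise, is the trajectory
   driven by the control u from the initial state (s0, v0). *)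
Definition trajectory (R : realType) (omega0 zeta s0 v0 : R)
    (u x1 x2 : R -> R) : Prop :=
  [/\ W12 x1 /\ W12 x2,
      ae_deriv x1 x2,
      ae_deriv x2 (fun t => - omega0 ^+ 2 * x1 t
                            - 2 * zeta * omega0 * x2 t + u t)
    & x1 0 = s0 /\ x2 0 = v0].

Definition steering_controls (R : realType) (omega0 zeta s0 v0 sf vf : R) :
    set (R -> R) :=
  [set u | L2 u /\ exists x1 x2 : R -> R,
    [/\ trajectory omega0 zeta s0 v0 u x1 x2,
        x1 (2 * pi) = sf & x2 (2 * pi) = vf]].

Definition is_L2_projection (R : realType) (A : set (R -> R))
    (um p : R -> R) : Prop :=
  A p /\ forall u, A u ->
    2^-1 * L2norm (p \- um) ^+ 2 <= 2^-1 * L2norm (u \- um) ^+ 2.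

(* Main.v *)
Require Import Defs.
From HB Require Import structures.
From mathcomp Require Import all_boot all_order all_algebra.
From mathcomp Require Import all_classical all_reals all_analysis measurable_realfun.
From mathcomp Require Import ring lra.
Import Order.TTheory GRing.Theory Num.Theory.
Import numFieldNormedType.Exports.
Local Open Scope classical_set_scope.
Local Open Scope ring_scope.

(** The controls steering the oscillator between two given states form an affine
    set, so the projection of [um] is characterized by orthogonality: a steering
    control [P] is the projection as soon as [P - um] is orthogonal to every
    difference of two steering controls ([steering_projection], by Pythagoras,
    which also yields uniqueness).

    If [w] solves the adjoint equation [w'' = 2 alpha w' - omega0^2 w] and
    [(q1, q2)] is the difference of two trajectories with the same endpoints, then
    [(2 alpha w - w') q1 + w q2] vanishes at [0] and [2 pi], and its derivative is
    almost everywhere [w] times the difference of the controls. Hence the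
    solutions of the adjoint equation, which are the combinations of
    [e^(alpha t) sin (beta t)] and [e^(alpha t) cos (beta t)], are orthogonal to
    all these differences ([steering_controls_orthogonal]). As trajectories are
    only absolutely continuous, this rests on the fundamental theorem of calculus
    for such functions ([abs_continuous_FTC]), which reduces to the fact that an
    absolutely continuous function with almost everywhere zero derivative takes
    equal values at the endpoints ([abs_continuous_ae_derive0]).

    It remains to see that the announced [P] differs from [um] by such a [w], and
    that it steers to [(sf, vf)]. The response from rest to [w] has a closed form,
    whose value at [2 pi] is a linear function of the two coefficients of [w]
    ([response_2pi], [response'_2pi]). The formula for [P] solves this two by two
    linear system for the missing displacement. The system is regular because
    its determinant is positive ([gramian_det_gt0]), which comes down to
    [sinh x > x] and [|sin x| <= x]. *)

(** * Absolutely continuous functions *)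

Section AbsolutelyContinuous.
Context {R : realType}.
Implicit Types (a b : R) (f g h : R -> R).

(** Induction along a segment: a property that holds at [a] and passes from
    the left of every point to its right, within a gauge depending on the point,
    holds at [b]. It plays the role of Cousin's lemma on tagged partitions. *)
Lemma real_induction a b (Q : R -> Prop) : a <= b -> Q a ->
  (forall c, a <= c <= b -> exists2 d : R, 0 < d &
    forall x y, a <= x -> x <= c -> c <= y -> y <= b ->
      c - d < x -> y < c + d -> Q x -> Q y) ->
  Q b.
Proof.
move=> ab Qa step.
pose S := [set x | a <= x <= b /\ Q x].
have Sa : S a by split; rewrite ?lexx ?ab.
have ubS : ubound S b by move=> x [/andP[]].
have supS : has_sup S by split; [exists a | exists b].
set c := sup S.
have ac : a <= c by apply: ub_le_sup => //; exists b.
have cb : c <= b by apply: ge_sup => //; exists a.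
have [d d0 stepc] := step c (introT andP (conj ac cb)).
have [x [/andP[ax xb] Qx] cx] := sup_adherent d0 supS.
have xc : x <= c by apply: ub_le_sup; [exists b | split; rewrite ?ax].
have [bd|db] := ltP b (c + d); first exact: (stepc x b).
have cy : c < c + d / 2 by rewrite ltrDl divr_gt0.
have Sy : S (c + d / 2).
  split; last by apply: (stepc x) => //; rewrite -/c; lra.
  by apply/andP; split; lra.
suff : c + d / 2 <= c by rewrite leNgt cy.
by apply: ub_le_sup => //; exists b.
Qed.

Lemma abs_continuous_cst a b (k : R) : abs_continuous a b (cst k).
Proof.
move=> e e0; exists 1 => // n l r _ _ _.
by rewrite big1// => i _; rewrite /cst subrr normr0.
Qed.

Lemma abs_continuousD a b f g : abs_continuous a b f -> abs_continuous a b g ->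
  abs_continuous a b (f \+ g).
Proof.
move=> cf cg e e0; have e20 : 0 < e / 2 by rewrite divr_gt0.
have [df df0 Hf] := cf _ e20; have [dg dg0 Hg] := cg _ e20.
exists (Num.min df dg); first by rewrite lt_min df0 dg0.
move=> n l r lr tlr; rewrite lt_min => /andP[sf sg].
have := Hf n l r lr tlr sf; have := Hg n l r lr tlr sg => lg lf.
rewrite [ltRHS]splitr; apply: le_lt_trans (ltrD lf lg).
rewrite -big_split/=; apply: ler_sum => i _.
by rewrite opprD addrACA; exact: ler_normD.
Qed.

Lemma abs_continuous_bounded a b f : a <= b -> abs_continuous a b f ->
  exists M, forall t, a <= t <= b -> `|f t| <= M.
Proof.
move=> ab cf; have [d d0 Hd] := cf 1 ltr01.
have near_f s t : a <= s -> s <= t -> t <= b -> t - s < d -> `|f t - f s| < 1.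
  move=> sa st tb sd; have := Hd 1%N (fun=> s) (fun=> t).
  rewrite !big_ord1; apply=> //.
  by apply/trivIsetP => i j _ _; rewrite !ord1.
suff [M HM] : exists M, forall t, a <= t <= b -> `|f t| <= M by exists M.
apply: (@real_induction a b
  (fun x => exists M, forall t, a <= t <= x -> `|f t| <= M)) => //.
  exists `|f a| => t /andP[at_ ta]; suff -> : t = a by [].
  by apply/eqP; rewrite eq_le at_ ta.
move=> c /andP[ac cb]; exists d => // x y ax xc cy yb cdx ycd [M HM].
exists (Num.max M (`|f c| + 1)) => t /andP[at_ ty]; rewrite le_max.
have [tx|xt] := leP t x; first by rewrite HM// at_.
apply/orP; right.
suff H : `|f t - f c| < 1.
  rewrite -(subrK (f c) (f t)) (le_trans (ler_normD _ _))// addrC lerD2l.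
  exact: ltW.
have [ct|tc] := leP c t; first by apply: near_f => //; lra.
by rewrite distrC; apply: near_f => //; lra.
Qed.

Lemma abs_continuousM a b f g : a <= b -> abs_continuous a b f ->
  abs_continuous a b g -> abs_continuous a b (f \* g).
Proof.
move=> ab cf cg.
have [M HM] := abs_continuous_bounded _ _ _ ab cf.
have [K HK] := abs_continuous_bounded _ _ _ ab cg.
(* A positive bound for both functions; the 1 allows the division by [L]. *)
pose L := Num.max M K + 1.
have a_in : a <= a <= b by rewrite lexx ab.
have L0 : 0 < L.
  rewrite /L ltr_wpDl// (le_trans (normr_ge0 (f a)))// le_max.
  by rewrite HM.
have fL t : a <= t <= b -> `|f t| <= L.
  by move=> /HM tM; rewrite (le_trans tM)// /L ler_wpDr// le_max lexx.
have gL t : a <= t <= b -> `|g t| <= L.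
  by move=> /HK tM; rewrite (le_trans tM)// /L ler_wpDr// le_max lexx orbT.
move=> e e0; have e20 : 0 < e / L / 2 by rewrite !divr_gt0.
have [df df0 Hf] := cf _ e20; have [dg dg0 Hg] := cg _ e20.
exists (Num.min df dg); first by rewrite lt_min df0 dg0.
move=> n l r lr tlr; rewrite lt_min => /andP[sf sg].
have := Hf n l r lr tlr sf; have := Hg n l r lr tlr sg => lg lf.
have -> : e = L * (e / L / 2 + e / L / 2).
  by rewrite -splitr mulrCA divff ?mulr1// gt_eqF.
apply: le_lt_trans (_ : _ <= L * (\sum_i `|f (r i) - f (l i)|
                                  + \sum_i `|g (r i) - g (l i)|)) _; last first.
  by rewrite ltr_pM2l// ltrD.
rewrite -big_split/= mulr_sumr; apply: ler_sum => i _.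
have [al ilr rb] := lr i.
have -> : f (r i) * g (r i) - f (l i) * g (l i) =
   (f (r i) - f (l i)) * g (r i) + f (l i) * (g (r i) - g (l i)) by ring.
rewrite (le_trans (ler_normD _ _))// !normrM mulrDr lerD//.
  by rewrite mulrC ler_wpM2r// gL// rb (le_trans al).
by rewrite ler_wpM2r// fL// al (le_trans ilr).
Qed.

Lemma abs_continuousB a b f g : a <= b -> abs_continuous a b f ->
  abs_continuous a b g -> abs_continuous a b (f \- g).
Proof.
move=> ab cf cg; have -> : f \- g = f \+ (cst (-1) \* g).
  by apply/funext => x /=; rewrite mulN1r.
apply: abs_continuousD => //; apply: abs_continuousM => //.
exact: abs_continuous_cst.
Qed.

Lemma lipschitz_abs_continuous a b f (K : R) :
  (forall s t, a <= s -> s <= t -> t <= b -> `|f t - f s| <= K * (t - s)) ->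
  abs_continuous a b f.
Proof.
move=> fK e e0; exists (e / (`|K| + 1)); first by rewrite divr_gt0// ltr_wpDl.
move=> n l r lr _; rewrite ltr_pdivlMr ?ltr_wpDl// => H.
apply: le_lt_trans H; rewrite mulr_suml; apply: ler_sum => i _.
have [al ilr rb] := lr i.
rewrite (le_trans (fK _ _ al ilr rb))// mulrC ler_wpM2l ?subr_ge0//.
by rewrite (le_trans (ler_norm _))// lerDl.
Qed.

Lemma C1_abs_continuous a b f g : a <= b -> (forall t : R, is_derive t 1 f (g t)) ->
  continuous g -> abs_continuous a b f.
Proof.
move=> ab df cg.
have [M HM] : exists M, forall t, a <= t <= b -> `|g t| <= M.
  have cng : {within `[a, b], continuous (fun x => `|g x|)}.
    apply: continuous_subspaceT => x.
    exact: (@continuous_comp _ _ _ g (@Num.norm _ R) x (cg x) (@norm_continuous _ _ _)).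
  have [c cab Hc] := EVT_max ab cng.
  by exists `|g c| => t tab; apply: Hc; rewrite in_itv.
apply: (@lipschitz_abs_continuous _ _ _ M) => s t sa st tb.
have cf : {within `[s, t], continuous f}.
  apply: continuous_subspaceT => x.
  by apply/differentiable_continuous/derivable1_diffP.
have [z] := MVT_segment st (fun x _ => df x) cf.
rewrite in_itv/= => /andP[sz zt] ->.
rewrite normrM (ger0_norm (_ : 0 <= t - s)) ?subr_ge0//.
by rewrite ler_wpM2r ?subr_ge0// HM// (le_trans sa sz) (le_trans zt tb).
Qed.

End AbsolutelyContinuous.

(** * Fundamental theorem of calculus for absolutely continuous functions *)

Section FundamentalTheorem.
Context {R : realType}.
Notation mu := (@lebesgue_measure R).
Implicit Types (a b : R) (f g h : R -> R).

Lemma sum_length_disjoint_itvs n (l r : 'I_n -> R) :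
  (forall i, l i <= r i) -> trivIset setT (fun i => `]l i, r i[%classic) ->
  mu (\big[setU/set0]_(i < n) `]l i, r i[%classic) = (\sum_i (r i - l i))%:E.
Proof.
move=> lr tlr; rewrite measure_bigsetU_ord//= -sumEFin; apply: eq_bigr => i _.
rewrite lebesgue_measure_itv/= lte_fin.
have := lr i; rewrite le_eqVlt => /predU1P[->|->//].
by rewrite ltxx subrr.
Qed.

Lemma is_derive0_locally_flat h (c e : R) : 0 < e -> is_derive c (1 : R) h 0 ->
  exists2 d : R, 0 < d & forall y, `|y - c| < d -> `|h y - h c| <= e * `|y - c|.
Proof.
move=> e0 dh.
have [+ hc] := dh; rewrite /derivable => /cvgrPdist_le /(_ _ e0).
rewrite [lim _](hc : lim _ = 0).
rewrite near_withinE => -[d /= d0 Hd]; exists d => // y yd.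
have [->|yc] := eqVneq y c; first by rewrite !subrr normr0 mulr0.
have yc0 : y - c != 0 by rewrite subr_eq0.
have := Hd (y - c); rewrite /ball_/= sub0r normrN => /(_ yd yc0).
rewrite sub0r normrN /GRing.scale/= mulr1 subrK normrM normfV.
by rewrite mulrC ler_pdivrMr ?normr_gt0.
Qed.

(** An absolutely continuous function whose derivative vanishes almost
    everywhere has equal values at the two endpoints. The exceptional set is
    enclosed in an open set [U] of small measure. Along the segment, the increment
    of [h] is bounded by its variation over finitely many disjoint intervals
    contained in [U], plus a small multiple of the length covered so far. *)
Lemma abs_continuous_ae_derive0 a b h : a <= b -> abs_continuous a b h ->
  mu.-negligible [set t : R | a <= t <= b /\ ~ is_derive t 1 h 0] ->
  h b = h a.
Proof.
move=> ab ch [N [mN N0 subN]].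
apply/eqP; rewrite -subr_eq0 -normr_le0; apply/ler_addgt0Pl => e e0; rewrite addr0.
have ba1 : 0 < b - a + 1 by rewrite ltr_wpDl ?subr_ge0.
(* The final bound is [e' + e' * (b - a) = e]. *)
pose e' := e / (b - a + 1).
have e'0 : 0 < e' by rewrite divr_gt0.
have [d d0 Hd] := ch _ e'0.
have [U [oU NU muU]] : exists U : set R,
    [/\ open U, N `<=` U & (mu (U `\` N) < d%:E)%E].
  by apply: lebesgue_regularity_outer => //; rewrite [X in (X < _)%E]N0.
have mU : measurable U by exact: measurable_realfun.open_measurable.
have {}muU : (mu U < d%:E)%E.
  rewrite -(setDUK NU); apply: le_lt_trans muU.
  rewrite (le_trans (measureU2 _ _ _))//; first exact: measurableD.
  by rewrite [X in (X + _ <= _)%E]N0 add0e.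
pose Q x := exists n, exists l r : 'I_n -> R,
  [/\ forall i, [/\ a <= l i, l i <= r i, r i <= x & `]l i, r i[%classic `<=` U],
      trivIset setT (fun i => `]l i, r i[%classic)
    & `|h x - h a| <= \sum_i `|h (r i) - h (l i)| + e' * (x - a)].
suff [n [l [r [lr tlr Hh]]]] : Q b.
  have -> : e = e' + e' * (b - a).
    by rewrite -{1}(mulr1 e') -mulrDr addrC /e' divfK// gt_eqF.
  rewrite (le_trans Hh)// lerD2r ltW//; apply: Hd => //.
    by move=> i; have [? ? ? _] := lr i.
  rewrite -lte_fin -sum_length_disjoint_itvs//; last by move=> i; have [] := lr i.
  apply: le_lt_trans muU; apply: le_measure; rewrite ?inE//.
    exact: bigsetU_measurable.
  apply: (big_ind (fun A => A `<=` U)) => //.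
    by move=> A B AU BU t [/AU|/BU].
  by move=> i _; have [] := lr i.
apply: (@real_induction _ a b Q ab).
  exists 0%N, (fun=> a), (fun=> a); split; [by case| |].
    by apply/trivIsetP; case.
  by rewrite big_ord0 !subrr normr0 mulr0 addr0.
move=> c /andP[ac cb]; have [cN|cN] := pselect (N c).
  have [d' /= d'0 Hd'] : \forall t \near c, U t.
    by apply: open_nbhs_nbhs; split => //; exact: NU.
  exists d' => // x y ax xc cy yb cdx ycd [n [l [r [lr tlr Hx]]]].
  have xy : x <= y by exact: le_trans xc cy.
  (* Around an exceptional point, the interval from [x] to [y] lies in [U] and
     joins the family, as its element of index 0. *)
  exists n.+1, (fun i => oapp l x (unlift ord0 i)),
    (fun i => oapp r y (unlift ord0 i)).
  split.
  - move=> i; case: unliftP => [j|] _ /=.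
      by have [? ? rx ?] := lr j; split => //; exact: le_trans rx xy.
    split => // t; rewrite /= in_itv/= => /andP[xt ty]; apply: Hd'.
    by rewrite /ball_/= ltr_norml; apply/andP; split; lra.
  - have sep (j : 'I_n) : `]l j, r j[ `&` `]x, y[ = set0 :> set R.
      rewrite -subset0 => t /=; rewrite !in_itv/= => -[/andP[_ tr] /andP[xt _]].
      have [_ _ rx _] := lr j.
      by have := lt_trans (lt_le_trans tr rx) xt; rewrite ltxx.
    apply/trivIsetP => i j _ _; case: unliftP => [i'|] ->; case: unliftP => [j'|] -> /=.
    + by rewrite (inj_eq lift_inj) => ij; move/trivIsetP : tlr; apply.
    + by move=> _; exact: sep.
    + by move=> _; rewrite setIC; exact: sep.
    + by [].
  - rewrite big_ord_recl/= unlift_none/=.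
    under eq_bigr do rewrite liftK/=.
    have -> : h y - h a = (h y - h x) + (h x - h a) by ring.
    rewrite (le_trans (ler_normD _ _))// -addrA lerD2l (le_trans Hx)// lerD2l.
    by rewrite ler_pM2l// lerD2r.
(* Elsewhere [h] is flat near [c] and the family is unchanged. *)
have dh : is_derive c (1 : R) h 0.
  by apply: contrapT => nd; apply: cN; apply: subN; split => //; rewrite ac cb.
have [d' d'0 Hd'] := is_derive0_locally_flat _ _ _ e'0 dh.
exists d' => // x y ax xc cy yb cdx ycd [n [l [r [lr tlr Hx]]]].
exists n, l, r; split => //.
  by move=> i; have [? ? rx ?] := lr i; split => //; rewrite (le_trans rx)//
    (le_trans xc).
have -> : h y - h a = (h y - h c) - (h x - h c) + (h x - h a) by ring.
have -> : e' * (y - a) = e' * (y - c) + e' * (c - x) + e' * (x - a) by ring.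
have Hy : `|h y - h c| <= e' * (y - c).
  by rewrite (le_trans (Hd' _ _))// ger0_norm ?subr_ge0//; lra.
have Hx' : `|h x - h c| <= e' * (c - x).
  by rewrite (le_trans (Hd' _ _))// ler0_norm ?opprB//; lra.
rewrite (le_trans (ler_normD _ _))//.
have := ler_normB (h y - h c) (h x - h c); lra.
Qed.

(** Indefinite integrals are absolutely continuous, because the integral of
    [|g|] over a set is small when the measure of the set is. *)
Lemma abs_continuous_integral a b g : mu.-integrable setT (EFin \o g) ->
  abs_continuous a b (fun x => (\int[mu]_(t in `[a, x]) g t)%R).
Proof.
move=> ig e e0; have [d [d0 Hd]] := integral_normr_continuous ig e0.
exists d => // n l r lr tlr sd.
have le_lr i : l i <= r i by have [] := lr i.
pose U := \big[setU/set0]_(i < n) `]l i, r i[%classic.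
have mU : measurable U by exact: bigsetU_measurable.
have muU : (mu U < d%:E)%E by rewrite sum_length_disjoint_itvs.
apply: le_lt_trans (Hd U mU muU).
have iS A : measurable A -> mu.-integrable A (EFin \o g).
  by move=> mA; exact: integrableS ig.
have iN A : measurable A -> mu.-integrable A (EFin \o (fun x => `|g x|)).
  by move=> mA; exact: (integrable_abse (iS _ mA)).
have -> : (\int[mu]_(x in U) `|g x| =
           \sum_(i < n) \int[mu]_(x in `]l i, r i[) `|g x|)%R.
  rewrite /Rintegral integral_bigsetU_EFin//=.
  - rewrite sum_fine// => i _.
    by apply: integrable_fin_num => //; exact: iN.
  - exact: index_enum_uniq.
  - by apply: sub_trivIset tlr.
  - by apply: (measurable_int mu); exact: iN.
apply: ler_sum => i _; have [al _ rb] := lr i.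
rewrite Rintegral_itvB ?bnd_simp//; last exact: iS.
rewrite (le_trans (le_normr_Rintegral _ _))//; first exact: iS.
by rewrite -Rintegral_itv_bndo_bndc//; exact: iN.
Qed.

(** The fundamental theorem of calculus for absolutely continuous functions:
    by Lebesgue's differentiation theorem, [f] and the indefinite integral of
    [g] have the same derivative almost everywhere. *)
Lemma abs_continuous_FTC a b f g : a <= b -> abs_continuous a b f ->
  mu.-integrable `[a, b] (EFin \o g) ->
  mu.-negligible [set t : R | a <= t <= b /\ ~ is_derive t 1 f (g t)] ->
  (\int[mu]_(t in `[a, b]) g t)%R = f b - f a.
Proof.
move=> ab cf ig nf.
pose G := g \_ `[a, b]; pose F x := (\int[mu]_(t in `[a, x]) G t)%R.
have iG : mu.-integrable setT (EFin \o G).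
  by rewrite -restrict_EFin; apply/integrable_restrict => //=; rewrite setTI.
have locG : locally_integrable setT G by exact: integrable_locally.
have iGy (y : R) :
    mu.-integrable [set` Interval (BLeft a) (BRight y)] (EFin \o G).
  exact: integrableS iG.
have dF := FTC1 iGy locG.
have Fa : F a = 0 by rewrite /F set_itv1 Rintegral_set1.
have Fb : F b = (\int[mu]_(t in `[a, b]) g t)%R.
  by apply: eq_Rintegral => t tab; rewrite /G patchE tab.
pose h := f \- F.
suff : h b = h a by rewrite /h/= Fa Fb subr0; lra.
apply: abs_continuous_ae_derive0 => //.
  by apply: abs_continuousB => //; exact: abs_continuous_integral.
(* Lebesgue's theorem excludes the endpoint [a]. *)
have na : mu.-negligible [set a].
  by apply/negligibleP => //; exact: lebesgue_measure_set1.
apply: negligibleS (negligibleU na (negligibleU nf dF)) => t /= [tab nh].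
have [->|ta] := eqVneq t a; [by left|right].
have [df|ndf] := pselect (is_derive t 1 f (g t)); last by left; split.
right; apply: contra_not nh => /(_ _)[|dFt F't].
  by rewrite lte_fin lt_neqAle eq_sym ta; case/andP: tab.
have GE : G t = g t by rewrite /G patchE mem_set//= in_itv.
have -> : (0 : R) = g t - G t by rewrite GE subrr.
have dFG : is_derive t 1 F (G t).
  by apply: DeriveDef; [exact: dFt|rewrite -derive1E].
exact: is_deriveB.
Qed.

End FundamentalTheorem.

(** * Square-integrable functions for a restricted measure *)

Section RestrictedMeasure.
Context {d} {T : measurableType d} {R : realType}.
Variables (mu : {measure set T -> \bar R}) (D : set T) (mD : measurable D).

Lemma integral_mrestr (f : T -> \bar R) : measurable_fun [set: T] f ->
  (\int[mrestr mu mD]_x f x = \int[mu]_(x in D) f x)%E.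
Proof.
move=> mf; rewrite -(setUv D) integral_setU//; last 3 first.
- exact: measurableC.
- by rewrite setUv.
- by apply/disj_setPCl.
rewrite [X in (_ + X)%E](_ : _ = 0%E) ?adde0.
  apply: eq_measure_integral => A mA AD.
  by rewrite /= /mrestr setIidl.
apply: null_set_integral => //.
- exact: measurableC.
- exact: measurable_funS mf.
- by rewrite /= /mrestr setICl measure0.
Qed.

Lemma integrable_mrestr (f : T -> \bar R) :
  (mrestr mu mD).-integrable [set: T] f -> mu.-integrable D f.
Proof.
move=> /integrableP[mf foo]; apply/integrableP; split.
  exact: measurable_funS mf.
by rewrite -integral_mrestr//; exact: measurableT_comp.
Qed.

Lemma negligible_mrestr (A : set T) :
  (mrestr mu mD).-negligible A -> mu.-negligible (D `&` A).
Proof.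
move=> [N [mN N0 AN]]; exists (N `&` D); split => //; first exact: measurableI.
by rewrite setIC; apply: setSI.
Qed.

End RestrictedMeasure.

Section SquareIntegrable.
Context {R : realType}.
Notation mu := (@lebesgue_measure R).
Notation I := (`[(0 : R), 2 * pi]%classic).
Implicit Types (f g u v : R -> R).

Lemma L2D f g : L2 f -> L2 g -> L2 (f \+ g).
Proof.
move=> /= Lf Lg; apply: (Lfun_addr_closed (@muI R) (lee1n 2)).2 => //.
Qed.

Lemma L2Z (k : R) f : L2 f -> L2 (fun t => k * f t).
Proof.
move=> Lf; have -> : (fun t => k * f t) = k \o* f.
  by apply/funext => t /=; rewrite mulrC.
by apply: Lfun_scale => //; rewrite ler1n.
Qed.

Lemma L2B f g : L2 f -> L2 g -> L2 (f \- g).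
Proof.
move=> Lf Lg; have -> : f \- g = f \+ (fun t => (-1) * g t).
  by apply/funext => t /=; rewrite mulN1r.
by apply: L2D => //; exact: L2Z.
Qed.

Lemma continuous_L2 f : continuous f -> L2 f.
Proof.
move=> cf; have mf : measurable_fun setT f by exact: continuous_measurable_fun.
rewrite /L2/= inE; apply/andP; split; rewrite inE//=.
rewrite /finite_norm unlock /Lnorm poweR_lty//.
rewrite integral_mrestr; last first.
  apply: measurableT_comp => //; apply: (measurableT_comp (measurable_powR _)) => //.
  exact: measurableT_comp.
have : mu.-integrable I (EFin \o (fun x => `|f x| `^ 2)).
  apply: continuous_compact_integrable; first exact: segment_compact.
  apply: continuous_subspaceT => x.
  under eq_fun do rewrite powR_mulrn// real_normK ?num_real// expr2.
  by apply: continuousM; exact: cf.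
by move/integrable_lty; exact.
Qed.

Lemma L2_integrableM f g : L2 f -> L2 g ->
  (@muI R).-integrable setT (EFin \o (f \* g)).
Proof. by move=> Lf Lg; apply/Lfun1_integrable; exact: Lfun2_mul_Lfun1. Qed.

Lemma L2norm_sqr f : L2 f -> L2norm f ^+ 2 = (\int[@muI R]_t (f t ^+ 2))%R.
Proof.
move=> Lf; rewrite /L2norm -powR_mulrn; last by rewrite fine_ge0// Lnorm_ge0.
rewrite -fine_poweR powR_Lnorm//.
rewrite /Rintegral; congr fine; apply: eq_integral => t _ /=.
by rewrite powR_mulrn// real_normK ?num_real.
Qed.

#[global] Instance ae_muI_filter : Filter (nbhs (almost_everywhere (@muI R))).
Proof. exact: ae_filter_ringOfSetsType. Qed.

Lemma ae_deriv_negligible f g : ae_deriv f g ->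
  mu.-negligible [set t : R | 0 <= t <= 2 * pi /\ ~ is_derive t 1 f (g t)].
Proof.
by move=> /negligible_mrestr; apply: negligibleS => t /= [tI]; rewrite in_itv.
Qed.

End SquareIntegrable.

(** * Adjoint oscillations and optimality *)

Section DampedOscillations.
Context {R : realType}.
Implicit Types (a b A B t : R).

(** The exponentially modulated oscillations of rate [a] and frequency [b].
    For fixed [a] and [b], they form a vector space stable under
    differentiation. It contains the adjoint states below; the responses are
    sums of two such oscillations, of opposite rates. *)
Definition osc a b A B t : R :=
  expR (a * t) * (A * sin (b * t) + B * cos (b * t)).

Lemma is_derive_osc a b A B t :
  is_derive t 1 (osc a b A B) (osc a b (a * A - b * B) (b * A + a * B) t).
Proof.
have dl (k : R) : is_derive t 1 ( *%R k) k.
  by apply: is_derive_eq; rewrite /GRing.scale/=; ring.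
have de : is_derive t 1 (fun t => expR (a * t)) (a * expR (a * t)).
  by apply: (is_derive_eq (is_derive1_comp _ (dl a))); rewrite /GRing.scale/=; ring.
have ds : is_derive t 1 (fun t => sin (b * t)) (b * cos (b * t)).
  by apply: (is_derive_eq (is_derive1_comp _ (dl b))); rewrite /GRing.scale/=; ring.
have dc : is_derive t 1 (fun t => cos (b * t)) (- b * sin (b * t)).
  by apply: (is_derive_eq (is_derive1_comp _ (dl b))); rewrite /GRing.scale/=; ring.
have -> : osc a b A B = (fun t => expR (a * t)) *
   ((cst A * (fun t => sin (b * t))) + (cst B * (fun t => cos (b * t)))).
  by apply/funext.
apply: is_derive_eq; rewrite !fctE /GRing.scale/= /osc; ring.
Qed.

Lemma continuous_osc a b A B : continuous (osc a b A B).
Proof.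
move=> t; apply/differentiable_continuous/derivable1_diffP.
by have [] := is_derive_osc a b A B t.
Qed.

Lemma abs_continuous_osc c d a b A B : c <= d -> abs_continuous c d (osc a b A B).
Proof.
move=> cd; apply: C1_abs_continuous cd _ (continuous_osc a b _ _).
exact: is_derive_osc.
Qed.

End DampedOscillations.

Section Steering.
Context {R : realType}.
Notation mu := (@lebesgue_measure R).
Variables (omega0 zeta beta : R).
Let alpha := omega0 * zeta.
Hypothesis omega0E : omega0 ^+ 2 = alpha ^+ 2 + beta ^+ 2.

(** The oscillations of rate [alpha] and frequency [beta] solve the adjoint of
    the damped equation. They are orthogonal to the difference of two controls
    steering between the same states: with [(w1, w)] the adjoint trajectory,
    the pairing [Z] of [(w1, w)] with the difference of the two state
    trajectories vanishes at both ends and has derivative [w * (u - p)] almost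
    everywhere. *)
Lemma steering_controls_orthogonal (s0 v0 sf vf A B : R) (u p : R -> R) :
  steering_controls omega0 zeta s0 v0 sf vf u ->
  steering_controls omega0 zeta s0 v0 sf vf p ->
  (\int[@muI R]_t (osc alpha beta A B t * (u t - p t)))%R = 0.
Proof.
move=> [Lu [y1 [y2 [[[[cy1 _] [cy2 _]] dy1 dy2 [y10 y20]] y1f y2f]]]].
move=> [Lp [z1 [z2 [[[[cz1 _] [cz2 _]] dz1 dz2 [z10 z20]] z1f z2f]]]].
pose w := osc alpha beta A B.
pose w1 := osc alpha beta (alpha * A + beta * B) (alpha * B - beta * A).
pose g := fun t => w t * (u t - p t).
pose Z := (w1 \* (y1 \- z1)) \+ (w \* (y2 \- z2)).
have pi0 : 0 <= 2 * pi :> R by rewrite mulr_ge0// pi_ge0.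
have ig : (@muI R).-integrable setT (EFin \o g).
  apply: L2_integrableM; last exact: L2B.
  by apply: continuous_L2; exact: continuous_osc.
have cZ : abs_continuous 0 (2 * pi) Z.
  by apply: abs_continuousD; apply: abs_continuousM => //;
    first [exact: abs_continuous_osc | exact: abs_continuousB].
have dZ : ae_deriv Z g.
  rewrite /ae_deriv; near=> t.
  have d1 : is_derive t 1 y1 (y2 t) by near: t.
  have d2 : is_derive t 1 y2 (- omega0 ^+ 2 * y1 t - 2 * zeta * omega0 * y2 t + u t).
    by near: t.
  have d3 : is_derive t 1 z1 (z2 t) by near: t.
  have d4 : is_derive t 1 z2 (- omega0 ^+ 2 * z1 t - 2 * zeta * omega0 * z2 t + p t).
    by near: t.
  have dw := is_derive_osc alpha beta A B t.
  have dw1 := is_derive_osc alpha beta (alpha * A + beta * B) (alpha * B - beta * A) t.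
  have -> : Z = w1 * (y1 - z1) + w * (y2 - z2) by [].
  apply: is_derive_eq.
  rewrite omega0E !fctE /GRing.scale/= /g /w1 /w /osc /= /alpha.
  ring.
have : (\int[mu]_(t in `[0, 2 * pi]) g t)%R = Z (2 * pi) - Z 0.
  apply: abs_continuous_FTC => //; last exact: ae_deriv_negligible.
  exact: integrable_mrestr.
rewrite /Z/= y10 y20 z10 z20 y1f y2f z1f z2f !subrr !mulr0 addr0 subrr => <-.
by rewrite /Rintegral /muI integral_mrestr//; case/integrableP : ig.
Unshelve. all: by end_near. Qed.

Lemma ae_deriv_ext (f g h : R -> R) : ae_deriv f g -> g = h -> ae_deriv f h.
Proof. by move=> + <-. Qed.

(** Superposition: adding the continuously differentiable response to [w],
    starting at rest, to a trajectory driven by [u] yields one driven by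
    [u + w]. *)
Lemma trajectoryD (s0 v0 : R) (u w x1 x2 d1 d2 : R -> R) :
  trajectory omega0 zeta s0 v0 u x1 x2 ->
  continuous w ->
  (forall t : R, is_derive t 1 d1 (d2 t)) ->
  (forall t : R, is_derive t 1 d2
     (- omega0 ^+ 2 * d1 t - 2 * zeta * omega0 * d2 t + w t)) ->
  d1 0 = 0 -> d2 0 = 0 ->
  trajectory omega0 zeta s0 v0 (u \+ w) (x1 \+ d1) (x2 \+ d2).
Proof.
move=> [[[cx1 [g1 Lg1 dg1]] [cx2 [g2 Lg2 dg2]]] dx1 dx2 [x10 x20]] cw dd1 dd2 d10 d20.
have pi0 : 0 <= 2 * pi :> R by rewrite mulr_ge0// pi_ge0.
have cont (f g : R -> R) : (forall t : R, is_derive t 1 f (g t)) -> continuous f.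
  by move=> df t; apply/differentiable_continuous/derivable1_diffP.
have cd1 := cont _ _ dd1; have cd2 := cont _ _ dd2.
pose d3 t := - omega0 ^+ 2 * d1 t - 2 * zeta * omega0 * d2 t + w t.
have cd3 : continuous d3.
  move=> t; apply: cvgD; last exact: cw.
  by apply: cvgB; apply: cvgM; [exact: cvg_cst|exact: cd1|exact: cvg_cst|exact: cd2].
have addae (f g f' g' : R -> R) : ae_deriv f f' -> (forall t : R, is_derive t 1 g (g' t)) ->
    ae_deriv (f \+ g) (f' \+ g').
  move=> aef dg; apply: filterS aef => t df; have := dg t => dgt.
  exact: is_deriveD.
split.
- split; split.
  + by apply: abs_continuousD => //; exact: C1_abs_continuous dd1 cd2.
  + exists (g1 \+ d2); last exact: addae.
    by apply: L2D => //; exact: continuous_L2.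
  + by apply: abs_continuousD => //; exact: C1_abs_continuous dd2 cd3.
  + exists (g2 \+ d3); last exact: addae.
    by apply: L2D => //; exact: continuous_L2.
- exact: addae.
- apply: ae_deriv_ext (addae _ _ _ _ dx2 dd2) _.
  by apply/funext => t /=; ring.
- by rewrite /= x10 x20 d10 d20 !addr0.
Qed.

(** A steering control [P] which differs from [um] by an adjoint oscillation is
    the unique projection of [um]: by orthogonality, the squared distance of a
    steering control [u] to [um] exceeds that of [P] by the squared distance
    of [u] to [P]. *)
Lemma steering_projection (s0 v0 sf vf A B : R) (um P : R -> R) :
  L2 um -> steering_controls omega0 zeta s0 v0 sf vf P ->
  (forall t, P t = um t + osc alpha beta A B t) ->
  let K := steering_controls omega0 zeta s0 v0 sf vf in
  is_L2_projection K um P /\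
  (forall p : R -> R, is_L2_projection K um p -> p = P %[ae @muI R]).
Proof.
move=> Lum KP PE K.
pose w := osc alpha beta A B.
have Lw : L2 w by apply: continuous_L2; exact: continuous_osc.
have LP : L2 P by case: KP.
have sq f : L2 f -> (@muI R).-integrable setT (EFin \o (fun t => f t ^+ 2)).
  move=> Lf; have -> : (fun t => f t ^+ 2) = f \* f by apply/funext => t; rewrite expr2.
  exact: L2_integrableM.
have pythagoras u : K u ->
    L2norm (u \- um) ^+ 2 = L2norm (P \- um) ^+ 2 + L2norm (u \- P) ^+ 2.
  move=> Ku; have Lu : L2 u by case: Ku.
  rewrite !L2norm_sqr; [|exact: L2B..].
  rewrite -RintegralD//; [|by apply: sq; exact: L2B..].
  (* The cross term, twice the integral of [w * (u - P)], is zero. *)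
  rewrite -[RHS]addr0 -[X in _ = _ + X](mulr0 2).
  rewrite -(steering_controls_orthogonal _ _ _ _ A B _ _ Ku KP).
  rewrite -RintegralZl//; last by apply: L2_integrableM => //; exact: L2B.
  rewrite -RintegralD//.
  - by apply: eq_Rintegral => t _ /=; rewrite PE; ring.
  - by have := integrableD measurableT (sq _ (L2B _ _ LP Lum)) (sq _ (L2B _ _ Lu LP)).
  - by have := integrableZl measurableT 2 (L2_integrableM _ _ Lw (L2B _ _ Lu LP)).
have minP u : K u -> 2^-1 * L2norm (P \- um) ^+ 2 <= 2^-1 * L2norm (u \- um) ^+ 2.
  by move=> Ku; rewrite ler_pM2l ?invr_gt0// (pythagoras u)// lerDl sqr_ge0.
split; first by split.
move=> p [Kp minp]; have Lp : L2 p by case: Kp.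
have : L2norm (p \- P) ^+ 2 <= 0.
  have := minp _ KP; rewrite ler_pM2l ?invr_gt0// (pythagoras p)//.
  by rewrite gerDl.
rewrite (L2norm_sqr _ (L2B _ _ Lp LP)) => le0.
have ipP := sq _ (L2B _ _ Lp LP).
have int0 : (\int[@muI R]_t `|((p \- P) t ^+ 2)%:E| = 0)%E.
  under eq_integral do rewrite gee0_abs ?lee_fin ?sqr_ge0//.
  apply/eqP; rewrite eq_le integral_ge0 ?andbT; last by move=> t _; rewrite lee_fin sqr_ge0.
  by rewrite -[leLHS]fineK ?lee_fin//; exact: integrable_fin_num.
have [/(_ int0) + _] := ae_eq_integral_abs (@muI R) measurableT (measurable_int _ ipP).
apply: filterS => t /(_ I) /= [/eqP]; rewrite sqrf_eq0 subr_eq0 => /eqP pP _.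
by [].
Qed.

End Steering.

(** * Endpoint of the response to an adjoint oscillation *)

Section Estimates.
Context {R : realType}.
Implicit Types (a b A B t x : R).

Lemma sinh_gt x : 0 < x -> x < sinh x.
Proof.
move=> x0.
have dsh (t : R) : is_derive t 1 (@sinh R) ((expR t + expR (- t)) / 2).
  have -> : @sinh R = (fun t => (expR t - (expR \o -%R) t) * 2^-1) by [].
  have d1 : is_derive t 1 (-%R : R -> R) (-1).
    by apply: is_derive_eq; rewrite ?scaler1.
  have d2 : is_derive t 1 (expR \o -%R : R -> R) (- expR (- t)).
    by apply: (is_derive_eq (is_derive1_comp _ d1)); rewrite /GRing.scale/=; ring.
  have d3 : is_derive t 1 (expR - (expR \o -%R) : R -> R) (expR t - - expR (- t)).
    exact: is_deriveB.
  have -> : (fun t => (expR t - (expR \o -%R) t) / 2) =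
      2^-1 *: (expR - (expR \o -%R) : R -> R).
    by apply/funext => y; rewrite /= !fctE /GRing.scale/= mulrC.
  by apply: is_derive_eq; rewrite /GRing.scale/=; ring.
have csh : {within `[0, x], continuous (@sinh R)}.
  apply: continuous_subspaceT => t; apply/differentiable_continuous/derivable1_diffP.
  by have [] := dsh t.
have [c /[!in_itv]/= /andP[c0 _]] := MVT x0 (fun t _ => dsh t) csh.
have -> : @sinh R 0 = 0 by rewrite /sinh oppr0 subrr mul0r.
rewrite !subr0 => ->; rewrite ltr_pMl//.
have e1 : 1 < expR c by rewrite expR_gt1.
have eK : expR c * expR (- c) = 1 by rewrite -expRD subrr expR0.
(* Positivity of this square over an exponential says that [cosh c > 1]. *)
have : 0 < (expR c - 1) ^+ 2 * expR (- c).
  by rewrite mulr_gt0 ?expR_gt0// exprn_gt0// subr_gt0.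
have -> : (expR c - 1) ^+ 2 * expR (- c) =
  expR c * (expR c * expR (- c)) - 2 * (expR c * expR (- c)) + expR (- c) by ring.
by rewrite eK; lra.
Qed.

Lemma normr_sin_le x : 0 <= x -> `|sin x| <= x.
Proof.
move=> x0; have cs : {within `[0, x], continuous (@sin R)}.
  by apply: continuous_subspaceT; exact: continuous_sin.
have [c _] := MVT_segment x0 (fun t _ => is_derive_sin t) cs.
rewrite sin0 !subr0 => ->; rewrite normrM (ger0_norm x0).
by rewrite ler_piMl// cos_max.
Qed.

End Estimates.

Section Response.
Context {R : realType}.
Variables (omega0 zeta beta : R).
Let alpha := omega0 * zeta.
Hypothesis omega0E : omega0 ^+ 2 = alpha ^+ 2 + beta ^+ 2.
Hypotheses (alpha0 : 0 < alpha) (beta0 : 0 < beta).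

Let y11 := expR (- 2 * pi * alpha) / (4 * omega0 ^+ 2) *
    (cos (2 * pi * beta) * (1 - expR (4 * pi * alpha)) / alpha
     + sin (2 * pi * beta) * (1 + expR (4 * pi * alpha)) / beta).
Let y12 := sinh (2 * pi * alpha) * sin (2 * pi * beta)
             / (2 * alpha * beta).
Let y22 := expR (- 2 * pi * alpha) / 4 *
    (cos (2 * pi * beta) * (1 - expR (4 * pi * alpha)) / alpha
     - sin (2 * pi * beta) * (1 + expR (4 * pi * alpha)) / beta).

Let expN : expR (- 2 * pi * alpha) = (expR (2 * pi * alpha))^-1 :> R.
Proof. by rewrite -expRN !mulNr. Qed.

Let exp4 : expR (4 * pi * alpha) = expR (2 * pi * alpha) ^+ 2 :> R.
Proof. by rewrite expr2 -expRD; congr expR; ring. Qed.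

(** The determinant in the projection formula, with [y21 = - y12]. It equals
    [((sinh (2 pi alpha) / alpha)^2 - (sin (2 pi beta) / beta)^2) / (4 omega0^2)],
    where the first quotient exceeds [2 pi] and the second one is at most [2 pi]
    in absolute value. *)
Lemma gramian_det_gt0 : 0 < y11 * y22 + y12 ^+ 2.
Proof.
have pi2 : 0 < 2 * pi :> R by rewrite mulr_gt0// pi_gt0.
have a0 : alpha != 0 by rewrite gt_eqF.
have b0 : beta != 0 by rewrite gt_eqF.
have sh : 2 * pi < sinh (2 * pi * alpha) / alpha.
  by rewrite ltr_pdivlMr// sinh_gt// mulr_gt0.
have sn : `|sin (2 * pi * beta)| / beta <= 2 * pi.
  by rewrite ler_pdivrMr// normr_sin_le// mulr_ge0// ltW.
have sq : (sin (2 * pi * beta) / beta) ^+ 2 < (sinh (2 * pi * alpha) / alpha) ^+ 2.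
  rewrite -(real_normK (num_real (sin (2 * pi * beta) / beta))) normrM.
  rewrite (gtr0_norm (_ : 0 < beta^-1)) ?invr_gt0//.
  by rewrite (ltrXn2r _ _ (le_lt_trans sn sh))// mulr_ge0// ltW// invr_gt0.
have om0 : 0 < omega0 ^+ 2 by rewrite omega0E addr_gt0// exprn_gt0.
suff -> : y11 * y22 + y12 ^+ 2 =
    ((sinh (2 * pi * alpha) / alpha) ^+ 2 - (sin (2 * pi * beta) / beta) ^+ 2)
    / (4 * omega0 ^+ 2).
  by apply: divr_gt0; [rewrite subr_gt0|rewrite mulr_gt0].
rewrite /y11 /y12 /y22 /sinh expRN expN exp4.
have E0 : expR (2 * pi * alpha) != 0 by rewrite gt_eqF// expR_gt0.
move: (cos2Dsin2 (2 * pi * beta)) E0; rewrite omega0E in om0 *.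
move: (expR _) (cos _) (sin _) => E c s cs E0.
have {cs} c2 : c ^+ 2 = 1 - s ^+ 2 by rewrite -cs addrK.
have om0' : alpha ^+ 2 + beta ^+ 2 != 0 by rewrite gt_eqF.
apply/eqP; rewrite -subr_eq0; apply/eqP.
(* The two sides differ by a multiple of [c ^+ 2 + s ^+ 2 - 1]. *)
transitivity ((c ^+ 2 - (1 - s ^+ 2)) * (1 - E ^+ 2) ^+ 2
  / (16 * E ^+ 2 * (alpha ^+ 2 + beta ^+ 2) * alpha ^+ 2)).
  by field; rewrite ?E0 ?a0 ?b0 ?om0'.
by rewrite c2 subrr !mul0r.
Qed.

(** The response, from rest, of the oscillator to the control
    [osc alpha beta A B]. The first summand is the particular solution, whose
    derivative is the control divided by [4 * alpha]; the second one solves the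
    free equation and cancels the initial state. *)
Definition response (A B t : R) : R :=
  osc alpha beta ((alpha * A + beta * B) / (4 * alpha * omega0 ^+ 2))
                 ((alpha * B - beta * A) / (4 * alpha * omega0 ^+ 2)) t
  + osc (- alpha) beta
      ((alpha * beta * A - alpha ^+ 2 * B - omega0 ^+ 2 * B)
       / (4 * alpha * beta * omega0 ^+ 2))
      ((beta * A - alpha * B) / (4 * alpha * omega0 ^+ 2)) t.

(** The derivative of [response]. *)
Definition response' (A B t : R) : R :=
  osc alpha beta (A / (4 * alpha)) (B / (4 * alpha)) t
  + osc (- alpha) beta
      ((2 * alpha * B - beta * A) / (4 * alpha * beta))
      (- B / (4 * alpha)) t.

Lemma response0 A B : response A B 0 = 0.
Proof. by rewrite /response /osc !mulr0 expR0 sin0 cos0; ring. Qed.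

Lemma response'0 A B : response' A B 0 = 0.
Proof. by rewrite /response' /osc !mulr0 expR0 sin0 cos0; ring. Qed.

Let a0 : alpha != 0. Proof. by rewrite gt_eqF. Qed.
Let b0 : beta != 0. Proof. by rewrite gt_eqF. Qed.
Let ab0 : alpha ^+ 2 + beta ^+ 2 != 0.
Proof. by rewrite gt_eqF// addr_gt0// exprn_gt0. Qed.

Lemma is_derive_response A B (t : R) :
  is_derive t 1 (response A B) (response' A B t).
Proof.
apply: (is_derive_eq (is_deriveD (is_derive_osc _ _ _ _ _)
                                 (is_derive_osc _ _ _ _ _))).
rewrite /response' /osc !mulNr omega0E.
move: (expR _) (expR _) (sin _) (cos _) => E E' s c.
by field; rewrite a0 b0 ab0.
Qed.

Lemma is_derive_response' A B (t : R) :
  is_derive t 1 (response' A B)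
    (- omega0 ^+ 2 * response A B t - 2 * zeta * omega0 * response' A B t
     + osc alpha beta A B t).
Proof.
apply: (is_derive_eq (is_deriveD (is_derive_osc _ _ _ _ _)
                                 (is_derive_osc _ _ _ _ _))).
have -> : 2 * zeta * omega0 = 2 * alpha by rewrite /alpha; ring.
rewrite /response' /response /osc !mulNr omega0E.
move: (expR _) (expR _) (sin _) (cos _) => E E' s c.
by field; rewrite a0 b0 ab0.
Qed.

(** The state reached at time [2 pi] depends linearly on [(A, B)], through the
    coefficients of the projection formula. *)
Lemma response_2pi A B :
  response A B (2 * pi) = (beta * A - alpha * B) * y11 + B * y12.
Proof.
rewrite /response /y11 /y12 /sinh /osc.
have -> : - alpha * (2 * pi) = - (2 * pi * alpha) by ring.
rewrite (mulrC alpha (2 * pi)) (mulrC beta (2 * pi)) expRN expN exp4 omega0E.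
have E0 : expR (2 * pi * alpha) != 0 by rewrite gt_eqF// expR_gt0.
move: (expR _) (sin _) (cos _) E0 => E s c E0.
by field; rewrite E0 a0 b0 ab0.
Qed.

Lemma response'_2pi A B :
  response' A B (2 * pi) = (beta * A - alpha * B) * y12 - B * y22.
Proof.
rewrite /response' /y22 /y12 /sinh /osc.
have -> : - alpha * (2 * pi) = - (2 * pi * alpha) by ring.
rewrite (mulrC alpha (2 * pi)) (mulrC beta (2 * pi)) expRN expN exp4.
have E0 : expR (2 * pi * alpha) != 0 by rewrite gt_eqF// expR_gt0.
move: (expR _) (sin _) (cos _) E0 => E s c E0.
by field; rewrite E0 a0 b0.
Qed.

End Response.

(** * The projection formula *)

(** Removes the phase shift [gamma = atan (- alpha / beta)], whose cosine and
    sine are [beta / omega] and [- alpha / omega]. *)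
Lemma cosD_atan (R : realType) (omega alpha beta x : R) :
  0 < omega -> 0 < beta -> omega ^+ 2 = alpha ^+ 2 + beta ^+ 2 ->
  omega * cos (x + atan (- alpha / beta)) = beta * cos x + alpha * sin x.
Proof.
move=> omega0 beta0 omegaE.
have b0 : beta != 0 by rewrite gt_eqF.
have o0 : omega != 0 by rewrite gt_eqF.
have cg : cos (atan (- alpha / beta)) = beta / omega.
  rewrite cos_atan.
  have -> : 1 + (- alpha / beta) ^+ 2 = (omega / beta) ^+ 2.
    by rewrite [RHS]exprMn omegaE; field.
  by rewrite sqrtr_sqr gtr0_norm ?divr_gt0// invf_div.
have sg : sin (atan (- alpha / beta)) = - alpha / omega.
  have := atanK (- alpha / beta); rewrite /tan cg => h.
  have -> : sin (atan (- alpha / beta)) =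
     sin (atan (- alpha / beta)) / (beta / omega) * (beta / omega).
    by rewrite divfK// mulf_neq0// invr_eq0.
  by rewrite h; field; rewrite b0 o0.
by rewrite cosD cg sg; field.
Qed.

Theorem corollary7 (R : realType) (omega0 zeta s0 v0 sf vf : R)
    (um x1 x2 : R -> R) :
  0 < omega0 -> 0 < zeta -> zeta < 1 -> L2 um ->
  trajectory omega0 zeta s0 v0 um x1 x2 ->
  let alpha := omega0 * zeta in
  let beta := omega0 * Num.sqrt (1 - zeta ^+ 2) in
  let gamma := atan (- alpha / beta) in
  let y11 := expR (- 2 * pi * alpha) / (4 * omega0 ^+ 2) *
    (cos (2 * pi * beta) * (1 - expR (4 * pi * alpha)) / alpha
     + sin (2 * pi * beta) * (1 + expR (4 * pi * alpha)) / beta) in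
  let y12 := sinh (2 * pi * alpha) * sin (2 * pi * beta)
             / (2 * alpha * beta) in
  let y21 := - (sinh (2 * pi * alpha) * sin (2 * pi * beta)
                / (2 * alpha * beta)) in
  let y22 := expR (- 2 * pi * alpha) / 4 *
    (cos (2 * pi * beta) * (1 - expR (4 * pi * alpha)) / alpha
     - sin (2 * pi * beta) * (1 + expR (4 * pi * alpha)) / beta) in
  (* the endpoint state enters the formula in the same scaling
     beta / e^(-2 pi alpha) as the target state (sf, vf) *)
  let X1 := beta * x1 (2 * pi) / expR (- 2 * pi * alpha) in
  let X2 := beta * x2 (2 * pi) / expR (- 2 * pi * alpha) in
  let P := fun t : R =>
    um t + expR (alpha * (t - 2 * pi))
           / (beta ^+ 2 * (y11 * y22 - y12 * y21)) *
      (- (y22 * sin (beta * t) + y12 * omega0 * cos (beta * t + gamma))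
         * (X1 - beta * sf / expR (- 2 * pi * alpha))
       + (y21 * sin (beta * t) + y11 * omega0 * cos (beta * t + gamma))
         * (X2 - beta * vf / expR (- 2 * pi * alpha))) in
  let A := steering_controls omega0 zeta s0 v0 sf vf in
  is_L2_projection A um P /\
  (forall p : R -> R, is_L2_projection A um p -> p = P %[ae @muI R]).
Proof.
move=> om0 ze0 ze1 Lum traj alpha beta gamma y11 y12 y21 y22 X1 X2 P K.
have zz : 0 < 1 - zeta ^+ 2 by rewrite subr_gt0 expr_lt1// ltW.
have alpha0 : 0 < alpha by rewrite mulr_gt0.
have beta0 : 0 < beta by rewrite mulr_gt0// sqrtr_gt0.
have omE : omega0 ^+ 2 = alpha ^+ 2 + beta ^+ 2.
  by rewrite /alpha /beta !exprMn sqr_sqrtr ?ltW//; ring.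
have b0 : beta != 0 by rewrite gt_eqF.
have Delta_neq0 : y11 * y22 + y12 ^+ 2 != 0.
  by rewrite gt_eqF//; exact: gramian_det_gt0.
have DeltaE : y11 * y22 - y12 * y21 = y11 * y22 + y12 ^+ 2.
  by rewrite /y21 -/y12; ring.
pose Delta := y11 * y22 + y12 ^+ 2.
have DN : Delta != 0 := Delta_neq0.
pose D1 := x1 (2 * pi) - sf; pose D2 := x2 (2 * pi) - vf.
(* The coefficients of [P - um] in the basis of the oscillations. *)
pose A := (- (y22 + alpha * y12) * D1 + (alpha * y11 - y12) * D2)
          / (beta * Delta).
pose B := (- y12 * D1 + y11 * D2) / Delta.
have PE t : P t = um t + osc alpha beta A B t.
  rewrite /P DeltaE -/Delta -(mulrA y12 omega0) -(mulrA y11 omega0).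
  rewrite (cosD_atan _ omega0 alpha beta)//.
  have -> : expR (alpha * (t - 2 * pi)) = expR (alpha * t) * expR (- 2 * pi * alpha).
    by rewrite -expRD; congr expR; ring.
  have E0 : expR (- 2 * pi * alpha) != 0 by rewrite gt_eqF// expR_gt0.
  rewrite /osc /A /B /X1 /X2 /D1 /D2 (_ : y21 = - y12)//.
  by field; rewrite DN b0 E0.
have AB : beta * A - alpha * B = (- y22 * D1 - y12 * D2) / Delta.
  by rewrite /A /B; field; rewrite DN b0.
have KP : K P.
  split.
    rewrite (_ : P = um \+ osc alpha beta A B); last exact/funext.
    by apply: L2D => //; apply/continuous_L2/continuous_osc.
  exists (x1 \+ response omega0 zeta beta A B),
    (x2 \+ response' omega0 zeta beta A B).
  split.
  - rewrite (_ : P = um \+ osc alpha beta A B); last exact/funext.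
    apply: trajectoryD traj _ _ _ _ _.
    + exact: continuous_osc.
    + exact: is_derive_response.
    + exact: is_derive_response'.
    + exact: response0.
    + exact: response'0.
  - rewrite /= response_2pi// AB -/y11 -/y12 /B /D1 /Delta.
    by field.
  - rewrite /= response'_2pi// AB -/y22 -/y12 /B /D2 /Delta.
    by field.
exact: (steering_projection _ _ beta omE _ _ _ _ A B).
Qed.
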